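(* Let $a,b\in\mathbb{Z}_{\ge 0}$ and let $\{A_N(q)\}_{N\ge 0}$, $\{B_N(M,q)\}$ be sequences forming a Burge pair, i.e. $$B_N(M,q)=\sum_{j\ge 0}A_j(q)\,Q(N,M,aj,bj,q)\qquad\text{for all } N,M\in\mathbb{Z}_{\ge 0}.$$ Then for all $N,M\in\mathbb{Z}_{\ge 0}$, $$\sum_{i\ge 0} q^{(1+2M)i}\begin{bmatrix}2M+N-i\\ N-i\end{bmatrix}_q B_i(-1-M,q)=\sum_{j\ge 0}A_j(q)\,q^{2aj^2(a-b)}\,Q(N,M,aj,(2a-b)j,q),$$ where $B_i(-1-M,q)$ denotes $\sum_{j\ge0}A_j(q)\,Q(i,-1-M,aj,bj,q)$ (the defining formula evaluated at the negative integer $-1-M$, using the $q$-binomial convention below).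
   Context: $(x;q)_n=(1-x)(1-xq)\cdots(1-xq^{n-1})$ for $n>0$, $(x;q)_0=1$, and $(x)_n=(x;q)_n$. For integers $N$ and $j$, the $q$-binomial coefficient is $\begin{bmatrix}N\\ j\end{bmatrix}_q=\frac{(q^{N-j+1})_j}{(q)_j}$ if $j\ge 0$ and $0$ otherwise (this formula is used also when $N$ is negative). For integers $N,M,c,d$, $Q(N,M,c,d,q)=\begin{bmatrix}N+M+c-d\\ N+c\end{bmatrix}_q\begin{bmatrix}N+M-c+d\\ N-c\end{bmatrix}_q$. *)

(* Defs.v *)
From HB Require Import structures.
From mathcomp Require Import all_boot all_order all_algebra.
From mathcomp Require Import all_classical all_reals all_analysis.

Set Implicit Arguments.
Unset Strict Implicit.
Unset Printing Implicit Defensive.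

Import Order.TTheory GRing.Theory Num.Theory.

Local Open Scope classical_set_scope.
Local Open Scope ring_scope.

(* Topological fields: the scalars may be a field with the discrete topology,
   the real or complex numbers, or formal Laurent series in q with the q-adic
   topology. When 0 < a every sum over j below is finite and the topology plays
   no role; it gives a meaning to the infinite sums that occur when a = 0. *)
HB.mixin Record isTopologicalField K & GRing.Field K & Topological K := {
  mulr_continuous : continuous (fun x : K * K => x.1 * x.2) ;
  invr_continuous : forall x : K, x != 0 -> {for x, continuous (@GRing.inv K)}
}.

#[short(type="topologicalFieldType")]
HB.structure Definition TopologicalField :=
  {K of GRing.Field K & TopologicalZmodule K & isTopologicalField K}.

Section Definitions.
Variable K : topologicalFieldType.
Implicit Types (q x : K) (N M c d j : int).

Definition sums_to (u : nat -> K) (l : K) : Prop := series u @ \oo --> l.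

Definition has_infsum (u : nat -> K) : Prop := exists l, sums_to u l.

(* Junk value 0 if u has no sum; the sum is unique when K is Hausdorff. *)
Definition infsum (u : nat -> K) : K := xget 0 (sums_to u).

Definition qpoch x q (n : nat) : K := \prod_(k < n) (1 - x * q ^+ k).

Definition qbinom q N j : K :=
  if 0 <= j then qpoch (q ^ (N - j + 1)) q `|j|%N / qpoch q q `|j|%N else 0.

Definition burgeQ N M c d q : K :=
  qbinom q (N + M + c - d) (N + c) * qbinom q (N + M - c + d) (N - c).

Definition burge_term (a b : nat) q (A : nat -> K) N M (j : nat) : K :=
  A j * burgeQ N M (a%:Z * j%:Z) (b%:Z * j%:Z) q.

Definition burge_pair (a b : nat) q (A : nat -> K) (B : nat -> int -> K) :
    Prop :=
  forall N M : nat, has_infsum (burge_term a b q A N%:Z M%:Z) /\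
    B N M%:Z = infsum (burge_term a b q A N%:Z M%:Z).

End Definitions.

(* Main.v *)
Require Import Defs.
From HB Require Import structures.
From mathcomp Require Import all_boot all_order all_algebra.
From mathcomp Require Import all_classical all_reals all_analysis.
From mathcomp Require Import ring zify.

(* With [c = a j] and [d = b j], the coefficient of [A j] on both sides gives a
   finite identity which, once [x = q ^ (- M - d)], [y = q ^ (d - M)] and
   [U = q ^ (2 M + 1)] (so that [x y U = q]) are substituted, is the
   q-Pfaff-Saalschuetz sum up to the reversal of a q-shifted factorial.
   Creative telescoping gives a first-order recurrence for the latter. Summing
   over [j] only uses linearity of convergent series. Convergence at [-1 - M]
   matters only for [a = 0]: then [Q(i, M, 0, d)] is a polynomial of degree [i]
   in [q ^ d + q ^ (- d)] for every [M], hence a combination of the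
   [Q(k, 0, 0, d)] with [k <= i]. *)

Set Implicit Arguments.
Unset Strict Implicit.
Unset Printing Implicit Defensive.

Import Order.TTheory GRing.Theory Num.Theory.

Local Open Scope classical_set_scope.
Local Open Scope ring_scope.

Section InfiniteSums.
Variable K : topologicalFieldType.
Implicit Types (u v : nat -> K) (l m c : K).

Lemma sums_toD u v l m :
  sums_to u l -> sums_to v m -> sums_to (u + v) (l + m).
Proof.
move=> ul vm; rewrite /sums_to seriesD.
by apply: continuous2_cvg ul vm; exact: (@add_continuous K (l, m)).
Qed.

Lemma sums_toZ c u l : sums_to u l -> sums_to (fun j => c * u j) (c * l).
Proof.
move=> ul; rewrite /sums_to.
have -> : series (fun j => c * u j) = fun n => c * series u n.
  by apply/funext => n; rewrite /series /= mulr_sumr.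
by apply: continuous2_cvg (cvg_cst c) ul; exact: (@mulr_continuous K (c, l)).
Qed.

Lemma sums_to_finite u n :
  (forall j, (n <= j)%N -> u j = 0) -> sums_to u (\sum_(j < n) u j).
Proof.
move=> u0; apply: cvg_near_cst; exists n => // m /= /subnKC <-.
rewrite seriesEord /= big_split_ord /= [X in _ + X]big1 ?addr0 // => i _.
by rewrite u0 ?leq_addr.
Qed.

Lemma sums_to_sum n (u : nat -> nat -> K) (l : nat -> K) :
  (forall i, sums_to (u i) (l i)) ->
  sums_to (fun j => \sum_(i < n) u i j) (\sum_(i < n) l i).
Proof.
move=> ul; elim: n => [|n IH].
  have := @sums_to_finite (fun=> 0) 0 (fun _ _ => erefl).
  by rewrite !big_ord0; congr sums_to; apply/funext => j; rewrite big_ord0.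
have := sums_toD IH (ul n).
by congr sums_to; [apply/funext => j|]; rewrite big_ord_recr.
Qed.

Lemma has_infsumP u : has_infsum u -> sums_to u (infsum u).
Proof. exact: xgetPex. Qed.

Lemma infsum_eq u l : hausdorff_space K -> sums_to u l -> infsum u = l.
Proof.
by move=> hK ul; apply: (cvg_unique hK (has_infsumP _) ul); exists l.
Qed.

Lemma has_infsum_horner (A y : nat -> K) (P : nat -> {poly K}) :
  (forall n, size (P n) = n.+1) ->
  (forall n, has_infsum (fun j => A j * (P n).[y j])) ->
  forall p, has_infsum (fun j => A j * p.[y j]).
Proof.
move=> sizeP sumP p; move: {2}(size p) (leqnn (size p)) => n.
elim: n p => [|n IH] p.
  rewrite leqn0 size_poly_eq0 => /eqP ->; exists (\sum_(j < 0) A j * 0.[y j]).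
  by apply: sums_to_finite => j _; rewrite horner0 mulr0.
move=> size_p; pose c := p`_n / lead_coef (P n).
have coef_Pn : (P n)`_n = lead_coef (P n) by rewrite lead_coefE sizeP.
have size_rem : (size (p - c *: P n)%R <= n)%N.
  apply/leq_sizeP => j; rewrite leq_eqVlt coefB coefZ => /predU1P[<-|nj].
    by rewrite coef_Pn divfK ?subrr // lead_coef_eq0 -size_poly_eq0 sizeP.
  by rewrite !nth_default ?mulr0 ?subrr // ?sizeP // (leq_trans size_p).
have [l sum_rem] := IH _ size_rem; have [m sum_Pn] := sumP n.
exists (l + c * m); have := sums_toD sum_rem (sums_toZ (c := c) sum_Pn).
congr sums_to; apply/funext => j.
by rewrite addrfctE /= hornerD hornerN hornerZ; ring.
Qed.

End InfiniteSums.

Section QSeries.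
Variables (K : topologicalFieldType) (q : K).
Hypothesis q_neq0 : q != 0.
Hypothesis q_nonroot : forall n : nat, (0 < n)%N -> q ^+ n != 1.
Implicit Types (a b c x y z U : K) (M d : int).

Lemma qpoch0 x : qpoch x q 0 = 1.
Proof. by rewrite /qpoch big_ord0. Qed.

Lemma qpochS x n : qpoch x q n.+1 = qpoch x q n * (1 - x * q ^+ n).
Proof. by rewrite /qpoch big_ord_recr. Qed.

Lemma qpochD x m n :
  qpoch x q (m + n) = qpoch x q m * qpoch (x * q ^+ m) q n.
Proof.
elim: n => [|n IH]; first by rewrite addn0 qpoch0 mulr1.
by rewrite addnS !qpochS IH exprD !mulrA.
Qed.

Lemma subr_qX_neq0 n : (0 < n)%N -> 1 - q ^+ n != 0.
Proof. by move=> /q_nonroot; rewrite subr_eq0 eq_sym. Qed.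

Lemma qpoch_qq_neq0 n : qpoch q q n != 0.
Proof.
elim: n => [|n IH]; first by rewrite qpoch0 oner_neq0.
by rewrite qpochS mulf_neq0 // -exprS subr_qX_neq0.
Qed.

Lemma qpoch_reverse x z n :
  x * z * q ^+ n = q -> qpoch x q n = (- x) ^+ n * q ^+ 'C(n, 2) * qpoch z q n.
Proof.
move=> xz; rewrite /qpoch [in RHS](reindex_inj rev_ord_inj) /=.
have -> : (- x) ^+ n = \prod_(k < n) (- x) by rewrite prodr_const card_ord.
rewrite -bin2_sum expr_sum big_mkord -!big_split /=; apply: eq_bigr => k _.
have xz1 : x * z * q ^+ (n - k.+1) * q ^+ k = 1.
  apply: (mulIf q_neq0); rewrite mul1r -[RHS]xz -!mulrA -exprSr -exprD.
  by rewrite subnK.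
by rewrite -[X in X - _ = _]xz1; ring.
Qed.

Definition qratio x n : K := qpoch x q n / qpoch q q n.

Lemma qratio0 x : qratio x 0 = 1.
Proof. by rewrite /qratio !qpoch0 divr1. Qed.

Lemma qratioS x n :
  qratio x n.+1 = qratio x n * ((1 - x * q ^+ n) / (1 - q ^+ n.+1)).
Proof. by rewrite /qratio !qpochS -exprS invfM; ring. Qed.

Lemma qratioD x m n :
  qratio x (m + n)%N =
  qratio x m * (qpoch (x * q ^+ m) q n / qpoch (q ^+ m.+1) q n).
Proof. by rewrite /qratio !qpochD -exprS invfM; ring. Qed.

Section Saalschutz.
Variables a b c U : K.
Hypothesis abU : a * b * U = c.
Hypothesis qpoch_c_neq0 : forall n, qpoch c q n != 0.

Definition saalschutz_term m k : K :=
  U ^+ k * qratio U m * qratio b k * (qpoch a q k / qpoch c q k).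

(* The WZ certificate produced by the q-Zeilberger algorithm. *)
Definition saalschutz_cert m k : K :=
  q ^+ m * (1 - q ^+ k) * (1 - c / q * q ^+ k) * saalschutz_term m k.

Lemma saalschutz_cert0 m : saalschutz_cert m 0 = 0.
Proof. by rewrite /saalschutz_cert subrr mulr0 !mul0r. Qed.

Let lhs_coef n : K := (1 - q ^+ n.+1) * (1 - c * q ^+ n).
Let rhs_coef n : K := (1 - a * U * q ^+ n) * (1 - b * U * q ^+ n).

Lemma subr_cqX_neq0 n : 1 - c * q ^+ n != 0.
Proof. by have := qpoch_c_neq0 n.+1; rewrite qpochS mulf_eq0 => /norP[]. Qed.

Lemma saalschutz_termSl m k :
  saalschutz_term m.+1 k =
  saalschutz_term m k * ((1 - U * q ^+ m) / (1 - q ^+ m.+1)).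
Proof. by rewrite /saalschutz_term qratioS; ring. Qed.

Lemma saalschutz_termSr m k :
  (1 - q ^+ k.+1) * (1 - c * q ^+ k) * saalschutz_term m k.+1 =
  U * (1 - a * q ^+ k) * (1 - b * q ^+ k) * saalschutz_term m k.
Proof.
rewrite /saalschutz_term qratioS !qpochS [U ^+ k.+1]exprS.
have := subr_qX_neq0 (ltn0Sn k); move: (q ^+ k.+1) => Q Q_neq1; field.
by rewrite Q_neq1 subr_cqX_neq0 qpoch_c_neq0.
Qed.

Lemma saalschutz_certP m k :
  lhs_coef (m + k) * saalschutz_term m.+1 k
    - rhs_coef (m + k) * saalschutz_term m k =
  saalschutz_cert m.+1 k - saalschutz_cert m k.+1.
Proof.
have -> : saalschutz_cert m k.+1 =
    q ^+ m * (U * (1 - a * q ^+ k) * (1 - b * q ^+ k) * saalschutz_term m k).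
  rewrite -saalschutz_termSr /saalschutz_cert [c / q * _]mulrAC exprSr.
  by field.
have := subr_qX_neq0 (ltn0Sn m); rewrite /saalschutz_cert saalschutz_termSl.
rewrite /lhs_coef /rhs_coef -abU !(exprS, exprD) => q_powS_neq1; field.
by rewrite q_powS_neq1.
Qed.

Lemma saalschutz_rec n :
  lhs_coef n * \sum_(k < n.+2) saalschutz_term (n.+1 - k)%N k =
  rhs_coef n * \sum_(k < n.+1) saalschutz_term (n - k)%N k.
Proof.
have telescoped : \sum_(k < n.+1)
    (lhs_coef n * saalschutz_term (n.+1 - k)%N k
     - rhs_coef n * saalschutz_term (n - k)%N k) =
    - saalschutz_cert 0 n.+1.
  pose f k := - saalschutz_cert (n.+1 - k) k.
  have -> : - saalschutz_cert 0 n.+1 = f n.+1 - f 0%N.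
    by rewrite /f subnn saalschutz_cert0 oppr0 subr0.
  rewrite -telescope_sumr // big_mkord; apply: eq_bigr => -[k /= kn] _.
  rewrite ltnS in kn.
  by rewrite /f opprK [RHS]addrC subSS subSn // -saalschutz_certP subnK.
have cert_last : saalschutz_cert 0 n.+1 = lhs_coef n * saalschutz_term 0 n.+1.
  by rewrite /saalschutz_cert /lhs_coef exprSr; field.
rewrite big_ord_recr /= subnn mulrDr -cert_last -[X in _ + X]opprK -telescoped.
by rewrite big_split /= sumrN -!mulr_sumr; ring.
Qed.

(* Divided by the term of index 0 this is the terminating balanced sum
   [3phi2 (a, b, q^-n; c, a b q^(1-n) / c; q, q)]. *)
Lemma qsaalschutz n :
  \sum_(k < n.+1) U ^+ k * qratio U (n - k)%N * qratio b k
    * (qpoch a q k / qpoch c q k) =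
  qratio (b * U) n * (qpoch (a * U) q n / qpoch c q n).
Proof.
rewrite -[LHS]/(\sum_(k < n.+1) saalschutz_term (n - k)%N k).
elim: n => [|n IH].
  by rewrite big_ord1 /saalschutz_term !qratio0 !qpoch0 expr0 divr1 !mulr1.
have lhs_coef_neq0 : lhs_coef n != 0.
  by rewrite mulf_neq0 ?subr_qX_neq0 ?subr_cqX_neq0.
apply: (mulfI lhs_coef_neq0); rewrite saalschutz_rec IH.
rewrite /lhs_coef /rhs_coef qratioS !qpochS.
have := subr_qX_neq0 (ltn0Sn n); move: (q ^+ n.+1) => Q Q_neq1; field.
by rewrite Q_neq1 subr_cqX_neq0 qpoch_c_neq0.
Qed.

End Saalschutz.

Lemma qsaalschutz_shift x y z U s n :
  x * y * U = q -> x * z * q ^+ s = q ->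
  \sum_(k < n.+1) U ^+ k * qratio U (n - k)%N
    * (qratio x (s + k)%N * qratio y k) =
  (- x) ^+ s * q ^+ 'C(s, 2)
    * (qratio z (s + n)%N * qratio (x * U * q ^+ s) n).
Proof.
move=> xyU xz.
have x_neq0 : x != 0 by apply: contraNneq q_neq0 => x0; rewrite -xz x0 !mul0r.
have zq : z * q ^+ s = y * U by apply: (mulfI x_neq0); rewrite !mulrA xz xyU.
have balanced : x * q ^+ s * y * U = q ^+ s.+1.
  by rewrite -!mulrA [q ^+ s * _]mulrC !mulrA xyU exprS.
have qs_neq0 k : qpoch (q ^+ s.+1) q k != 0.
  have := qpoch_qq_neq0 (s + k).
  by rewrite qpochD -exprS mulf_eq0 => /norP[].
have qratio_reverse : qratio x s = (- x) ^+ s * q ^+ 'C(s, 2) * qratio z s.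
  by rewrite /qratio (qpoch_reverse xz) mulrA.
transitivity (qratio x s * (qratio (y * U) n
    * (qpoch (x * U * q ^+ s) q n / qpoch (q ^+ s.+1) q n))).
  rewrite [x * U * _]mulrAC -(qsaalschutz balanced qs_neq0) mulr_sumr.
  by apply: eq_bigr => k _; rewrite qratioD; ring.
by rewrite qratio_reverse qratioD zq /qratio; ring.
Qed.

Lemma qbinomE (n : int) (k : nat) :
  qbinom q n k = qratio (q ^ (n - k%:Z + 1)) k.
Proof. by []. Qed.

Lemma qbinom_neg (n k : int) : k < 0 -> qbinom q n k = 0.
Proof. by rewrite /qbinom leNgt => ->. Qed.

Lemma burgeQ_eq0 (N c : nat) M d : (N < c)%N -> burgeQ N M c d q = 0.
Proof.
by move=> Nc; rewrite /burgeQ [X in _ * X]qbinom_neg ?mulr0 // subr_lt0 ltz_nat.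
Qed.

Lemma burgeQE (c n : nat) M d :
  burgeQ (c + n)%N M c d q =
  qratio (q ^ (M - d + 1)) (2 * c + n)%N * qratio (q ^ (M + d + 1)) n.
Proof.
rewrite /burgeQ.
have -> : (c + n)%N%:Z + c%:Z = (2 * c + n)%N by lia.
have -> : (c + n)%N%:Z - c%:Z = n by lia.
by rewrite !qbinomE; congr (qratio (q ^ _) _ * qratio (q ^ _) _); lia.
Qed.

Definition burge_weight (N : nat) M (i : nat) : K :=
  q ^ ((1 + 2 * M) * i%:Z) * qbinom q (2 * M + N%:Z - i%:Z) (N%:Z - i%:Z).

Lemma burge_weight_eq0 N M i : (N < i)%N -> burge_weight N M i = 0.
Proof.
by move=> Ni; rewrite /burge_weight qbinom_neg ?mulr0 // subr_lt0 ltz_nat.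
Qed.

Lemma burge_weightE N M i : (i <= N)%N ->
  burge_weight N M i =
  (q ^ (2 * M + 1)) ^+ i * qratio (q ^ (2 * M + 1)) (N - i)%N.
Proof.
move=> iN; rewrite /burge_weight subzn // qbinomE exprnP exprz_exp.
by congr (q ^ _ * qratio (q ^ _) _); lia.
Qed.

Lemma burge_weight_burgeQE (c n k : nat) M d (U := q ^ (2 * M + 1)) :
  (k <= n)%N ->
  burge_weight (c + n)%N M (c + k)%N * burgeQ (c + k)%N (-1 - M) c d q =
  U ^+ c * (U ^+ k * qratio U (n - k)%N
    * (qratio (q ^ (- M - d)) (2 * c + k)%N * qratio (q ^ (d - M)) k)).
Proof.
move=> kn; rewrite burge_weightE ?leq_add2l // subnDl burgeQE exprD.
have -> : -1 - M - d + 1 = - M - d by lia.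
have -> : -1 - M + d + 1 = d - M by lia.
by rewrite -/U; ring.
Qed.

Lemma sum_burge_weight_burgeQ (N c : nat) M d :
  \sum_(i < N.+1) burge_weight N M i * burgeQ i (-1 - M) c d q =
  q ^ (2 * c%:Z * (c%:Z - d)) * burgeQ N M c (2 * c%:Z - d) q.
Proof.
have [Nc|/subnKC <-] := ltnP N c.
  rewrite burgeQ_eq0 // mulr0 big1 // => i _.
  by rewrite burgeQ_eq0 ?mulr0 // (leq_trans (ltn_ord i)).
move: (N - c)%N => n {N}; rewrite -addnS big_split_ord /=.
rewrite big1 ?add0r; last by move=> i _; rewrite burgeQ_eq0 ?mulr0.
pose x := q ^ (- M - d); pose y := q ^ (d - M); pose U := q ^ (2 * M + 1).
pose z := q ^ (M - (2 * c%:Z - d) + 1).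
have xyU : x * y * U = q.
  by rewrite -!expfzDr // -[RHS]expr1z; congr (_ ^ _); lia.
have xz : x * z * q ^+ (2 * c) = q.
  by rewrite exprnP -!expfzDr // -[RHS]expr1z; congr (_ ^ _); lia.
have prefactor : U ^+ c * ((- x) ^+ (2 * c) * q ^+ 'C(2 * c, 2)) =
    q ^ (2 * c%:Z * (c%:Z - d)).
  have -> : 'C(2 * c, 2) = (c * (2 * c - 1))%N.
    by rewrite bin2 -mulnA mul2n doubleK; congr (_ * _)%N; lia.
  rewrite exprM sqrrN -exprM !exprnP !exprz_exp -!expfzDr //.
  by congr (_ ^ _); case: (c) => [|c']; nia.
under eq_bigr => k _ do rewrite burge_weight_burgeQE ?leq_ord //.
rewrite -mulr_sumr (qsaalschutz_shift _ xyU xz) mulrA prefactor burgeQE.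
congr (_ * (_ * qratio _ _)).
by rewrite exprnP -!expfzDr //; congr (_ ^ _); lia.
Qed.

Definition qsym d : K := q ^ d + q ^ (- d).

Definition burge_poly (i : nat) M : {poly K} :=
  (\prod_(k < i) (- q ^ (M + k%:Z + 1) / (1 - q ^+ k.+1) ^+ 2))
  *: \prod_(k < i) ('X - (qsym (M + k%:Z + 1))%:P).

Lemma size_burge_poly i M : size (burge_poly i M) = i.+1.
Proof.
rewrite size_scale; last first.
  apply/prodf_neq0 => k _.
  rewrite mulf_neq0 ?oppr_eq0 ?expfz_neq0 //.
  by rewrite invr_neq0 // expf_neq0 // subr_qX_neq0.
by rewrite size_prod_XsubC -[index_enum _]enumT size_enum_ord.
Qed.

Lemma horner_burge_poly (i : nat) M d :
  (burge_poly i M).[qsym d] = burgeQ i M 0 d q.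
Proof.
have -> : burgeQ i M 0 d q =
    qratio (q ^ (M - d + 1)) i * qratio (q ^ (M + d + 1)) i.
  exact: (burgeQE 0).
rewrite hornerZ horner_prod; elim: i => [|i IH].
  by rewrite !big_ord0 !qratio0.
rewrite !big_ord_recr /= mulrACA IH !qratioS [RHS]mulrACA; congr (_ * _).
have -> : M + i%:Z + 1 = (M + 1) + i%:Z by ring.
have -> : M - d + 1 = (M + 1) - d by ring.
have -> : M + d + 1 = (M + 1) + d by ring.
rewrite hornerXsubC /qsym -!invr_expz !expfzDr // -invr_expz -exprnP.
have := subr_qX_neq0 (ltn0Sn i); move: (q ^+ i.+1) => Q Q_neq1.
field.
by rewrite Q_neq1 q_neq0 !expfz_neq0 ?expf_neq0.
Qed.

Section BurgeTerms.
Variables (a b : nat) (A : nat -> K).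

Lemma has_infsum_burge_term M0 :
  (forall i : nat, has_infsum (burge_term a b q A i M0)) ->
  forall (i : nat) M, has_infsum (burge_term a b q A i M).
Proof.
move=> sumA i M; have [a0|a_gt0] := posnP a; last first.
  eexists; apply: (@sums_to_finite _ _ i.+1) => j ij.
  by rewrite /burge_term -PoszM burgeQ_eq0 ?mulr0 //; nia.
have termE (k : nat) L : burge_term a b q A k L =
    fun j => A j * (burge_poly k L).[qsym (b%:Z * j%:Z)].
  by apply/funext => j; rewrite /burge_term a0 mul0r horner_burge_poly.
rewrite termE; apply: (@has_infsum_horner _ A _ (burge_poly^~ M0)) => k.
  exact: size_burge_poly.
by rewrite -termE.
Qed.

Lemma sums_to_burge_transform (N : nat) M :
  (forall i : nat, has_infsum (burge_term a b q A i (-1 - M))) ->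
  sums_to (fun j => A j * q ^ (2 * a%:Z * j%:Z ^+ 2 * (a%:Z - b%:Z))
      * burgeQ N M (a%:Z * j%:Z) ((2 * a%:Z - b%:Z) * j%:Z) q)
    (\sum_(i < N.+1)
      burge_weight N M i * infsum (burge_term a b q A i (-1 - M))).
Proof.
move=> sumA; have := sums_to_sum (n := N.+1) (fun i =>
  sums_toZ (c := burge_weight N M i) (has_infsumP (sumA i))).
congr sums_to; apply/funext => j.
have -> : 2 * a%:Z * j%:Z ^+ 2 * (a%:Z - b%:Z) =
  2 * (a * j)%N%:Z * ((a * j)%N%:Z - b%:Z * j%:Z) by rewrite PoszM; ring.
have -> : (2 * a%:Z - b%:Z) * j%:Z = 2 * (a * j)%N%:Z - b%:Z * j%:Z.
  by rewrite PoszM; ring.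
rewrite -PoszM -mulrA -sum_burge_weight_burgeQ mulr_sumr.
by apply: eq_bigr => i _; rewrite /burge_term -PoszM mulrCA.
Qed.

End BurgeTerms.

End QSeries.

Theorem theorem2 (K : topologicalFieldType) (hK : hausdorff_space K)
  (q : K) (hq0 : q != 0) (hq : forall n : nat, (0 < n)%N -> q ^+ n != 1)
  (a b : nat) (A : nat -> K) (B : nat -> int -> K)
  (hAB : burge_pair a b q A B)
  (hBneg : forall i M : nat,
    B i (-1 - M%:Z) = infsum (burge_term a b q A i%:Z (-1 - M%:Z))) :
  forall N M : nat,
    let lhs (i : nat) : K :=
      q ^ ((1 + 2 * M%:Z) * i%:Z)
      * qbinom q (2 * M%:Z + N%:Z - i%:Z) (N%:Z - i%:Z)
      * B i (-1 - M%:Z) in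
    let rhs (j : nat) : K :=
      A j * q ^ (2 * a%:Z * j%:Z ^+ 2 * (a%:Z - b%:Z))
      * burgeQ N%:Z M%:Z (a%:Z * j%:Z) ((2 * a%:Z - b%:Z) * j%:Z) q in
    [/\ forall i : nat, has_infsum (burge_term a b q A i%:Z (-1 - M%:Z)),
        has_infsum lhs,
        has_infsum rhs
      & infsum lhs = infsum rhs].
Proof.
move=> N M lhs rhs.
have conv (i : nat) : has_infsum (burge_term a b q A i (-1 - M%:Z)).
  by apply: (has_infsum_burge_term hq0 hq (M0 := 0%N)) => k; case: (hAB k 0%N).
have lhs_sum : sums_to lhs (\sum_(i < N.+1) lhs i).
  apply: sums_to_finite => i Ni.
  by rewrite /lhs -/(burge_weight q N M i) burge_weight_eq0 ?mul0r.
have rhs_sum : sums_to rhs (\sum_(i < N.+1) lhs i).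
  under eq_bigr => i _ do rewrite /lhs hBneg.
  exact: sums_to_burge_transform.
split=> //; [by exists (\sum_(i < N.+1) lhs i)..|].
by rewrite (infsum_eq hK lhs_sum) (infsum_eq hK rhs_sum).
Qed.
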